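(* Let $\Bbbk$ be a field, let $a,b\ge2$ be integers, and put $s=\lceil a/b\rceil$, $m=a-s$. Under the bijection $\beta$ between below-diagonal rational $(a,b)$-Dyck paths and $\Omega_{a,b}$, there is an isomorphism of algebras \[ B^{\mathrm{st}}_{a,b}\cong\operatorname{Alg}\bigl(\mathcal C_{m-1}(\Omega_{a,b})\bigr). \] If $\gcd(a,b)=1$, this category algebra is Xing's algebra $B_0$.
   Context: $\operatorname{Dyck}^{\mathrm{below}}_{a,b}$ is the set of north-east lattice paths from $(0,0)$ to $(a,b)$ weakly below the diagonal $q=\frac ba p$, encoded by the increasing sequence $(x_1<\cdots<x_a)$ of positions of horizontal steps among the $a+b$ steps. For such a path $x_i=i$ for $i\le s$, and $\beta(x_1,\ldots,x_a)=(x_{s+1}-s,\ldots,x_a-s)$ is a bijection onto \[\Omega_{a,b}=\{1\le z_1<\cdots<z_m: z_j\le j+\lfloor b(s+j-1)/a\rfloor,\ 1\le j\le m\}.\] $\mathcal C_{m-1}(\Omega_{a,b})$ is the $\Bbbk$-linear category with object set $\Omega_{a,b}$, $\operatorname{Hom}(x,y)=\Bbbk f_{yx}$ if $x_i\le y_i$ for $1\le i\le m$ and $y_i<x_{i+1}$ for $1\le i\le m-1$, and $0$ otherwise; $f_{zy}f_{yx}=f_{zx}$ if $\operatorname{Hom}(x,z)\ne0$ and $0$ otherwise. For a finite $\Bbbk$-linear category $\mathcal A$, $\operatorname{Alg}(\mathcal A)=\bigoplus_{u,v}\operatorname{Hom}_{\mathcal A}(u,v)$ with multiplication given by composition. $\operatorname{os}_m(N)$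 is the set of strictly increasing $m$-tuples in $\{1,\ldots,N\}$; $x\preceq y$ means $x_1\le y_1<x_2\le y_2<\cdots<x_m\le y_m$. $A_n^m$ is the category algebra of the category with objects $\operatorname{os}_m(n+m-1)$, $\operatorname{Hom}(x,y)=\Bbbk f_{yx}$ if $x\preceq y$ and $0$ otherwise, $f_{zy}f_{yx}=f_{zx}$ if $x\preceq z$ and $0$ otherwise. With $A'=A_{b+1}^{\,m}$ and $e=\sum_{\ell\in\operatorname{Dyck}^{\mathrm{below}}_{a,b}}e_{\beta(\ell)}$, $B^{\mathrm{st}}_{a,b}=eA'e$. For $\gcd(a,b)=1$, Xing's algebra $B_0$ (arXiv:2511.22655) is defined as the endomorphism algebra of the projective summand, over $A_{b+1}^a$, indexed by the below-diagonal rational $(a,b)$-Dyck paths; Xing proved $B_0\cong eA'e$, and this description may be taken as the definition of $B_0$ here. *)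

(* Defs.v *)
From HB Require Import structures.
From mathcomp Require Import all_boot all_order all_algebra.
From mathcomp Require Import zify.
From mathcomp Require Import boolp.

Set Implicit Arguments.
Unset Strict Implicit.
Unset Printing Implicit Defensive.

Import GRing.Theory.
Local Open Scope ring_scope.

(* Finite k-linear categories; [hom x y] is the space of morphisms x -> y.    *)
(* The last field says that the category algebra is not the zero ring: the    *)
(* algebras of MathComp satisfy 1 != 0.                                       *)
Record linCat (k : fieldType) := LinCat {
  ob : finType;
  hom : ob -> ob -> vectType k;
  idm : forall x, hom x x;
  comp : forall x y z, hom y z -> hom x y -> hom x z;
  compA : forall x y z w (h : hom z w) (g : hom y z) (f : hom x y),
    comp h (comp g f) = comp (comp h g) f;
  comp1m : forall x y (f : hom x y), comp (idm y) f = f;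
  compm1 : forall x y (f : hom x y), comp f (idm x) = f;
  compPl : forall x y z c (g g' : hom y z) (f : hom x y),
    comp (c *: g + g') f = c *: comp g f + comp g' f;
  compPr : forall x y z c (g : hom y z) (f f' : hom x y),
    comp g (c *: f + f') = c *: comp g f + comp g f';
  linCat_neq0 : exists x, idm x != 0
}.
Arguments idm {k l} x.
Arguments comp {k l x y z} g f.

(* The direct sum of all the hom spaces. *)
Definition Alg (k : fieldType) (C : linCat k) : Type :=
  {dffun forall p : ob C * ob C, hom p.1 p.2 : vectType k}.

Section CategoryAlgebra.
Variables (k : fieldType) (C : linCat k).
Implicit Types (f g h : Alg C) (x y z w : ob C).

HB.instance Definition _ := Choice.on (Alg C).

Definition alg_at f (x y : ob C) : hom x y := f (x, y).

Lemma algP f g : (forall x y, alg_at f x y = alg_at g x y) <-> f = g.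
Proof.
split=> [eq_fg|->//]; apply/ffunP => -[x y]; exact: eq_fg.
Qed.

Definition alg_of (F : forall x y : ob C, hom x y) : Alg C :=
  [ffun p : ob C * ob C => F p.1 p.2 : hom p.1 p.2].

Lemma alg_ofE F x y : alg_at (alg_of F) x y = F x y.
Proof. by rewrite /alg_at ffunE. Qed.

Definition alg0 := alg_of (fun _ _ => 0).
Definition alg_opp f := alg_of (fun x y => - alg_at f x y).
Definition alg_add f g := alg_of (fun x y => alg_at f x y + alg_at g x y).

Fact alg_addA : associative alg_add.
Proof. by move=> f g h; apply/algP => x y; rewrite !alg_ofE addrA. Qed.
Fact alg_addC : commutative alg_add.
Proof. by move=> f g; apply/algP => x y; rewrite !alg_ofE addrC. Qed.
Fact alg_add0 : left_id alg0 alg_add.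
Proof. by move=> f; apply/algP => x y; rewrite !alg_ofE add0r. Qed.
Fact alg_addN : left_inverse alg0 alg_opp alg_add.
Proof. by move=> f; apply/algP => x y; rewrite !alg_ofE addNr. Qed.

HB.instance Definition _ :=
  GRing.isZmodule.Build (Alg C) alg_addA alg_addC alg_add0 alg_addN.

Definition alg_scale (c : k) f := alg_of (fun x y => c *: alg_at f x y).

Fact alg_scaleA c d f : alg_scale c (alg_scale d f) = alg_scale (c * d) f.
Proof. by apply/algP => x y; rewrite !alg_ofE scalerA. Qed.
Fact alg_scale1 : left_id 1 alg_scale.
Proof. by move=> f; apply/algP => x y; rewrite !alg_ofE scale1r. Qed.
Fact alg_scaleDr : right_distributive alg_scale +%R.
Proof. by move=> c f g; apply/algP => x y; rewrite !alg_ofE scalerDr. Qed.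
Fact alg_scaleDl f : {morph alg_scale^~ f : c d / c + d}.
Proof. by move=> c d; apply/algP => x y; rewrite !alg_ofE scalerDl. Qed.

HB.instance Definition _ := GRing.Zmodule_isLmodule.Build k (Alg C)
  alg_scaleA alg_scale1 alg_scaleDr alg_scaleDl.

Lemma alg_atD f g x y : alg_at (f + g) x y = alg_at f x y + alg_at g x y.
Proof. exact: alg_ofE. Qed.

Lemma alg_atZ c f x y : alg_at (c *: f) x y = c *: alg_at f x y.
Proof. exact: alg_ofE. Qed.

Lemma alg_at0 x y : alg_at 0 x y = 0.
Proof. exact: alg_ofE. Qed.

Lemma alg_at_sum I (r : seq I) (P : pred I) (F : I -> Alg C) x y :
  alg_at (\sum_(i <- r | P i) F i) x y = \sum_(i <- r | P i) alg_at (F i) x y.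
Proof.
by apply: (big_morph (fun f => alg_at f x y)) => [f g|];
  rewrite ?alg_atD ?alg_at0.
Qed.

(* The inclusion of the summand hom x y. *)
Definition alg_in x y (u : hom x y) : Alg C :=
  finfun (dfwith (fun p : ob C * ob C => 0 : hom p.1 p.2) (i := (x, y)) u).

Definition e_ x : Alg C := alg_in (idm x).

Lemma alg_in_at x y (u : hom x y) : alg_at (alg_in u) x y = u.
Proof. by rewrite /alg_at ffunE (dfwith_in _ (i := (x, y))). Qed.

Lemma alg_in_out x y (u : hom x y) x' y' :
  (x, y) != (x', y') -> alg_at (alg_in u) x' y' = 0.
Proof.
move=> neq; rewrite /alg_at ffunE.
by rewrite (@dfwith_out _ _ _ (x, y) u (x', y') neq).
Qed.

Definition alg_mul g f : Alg C :=
  alg_of (fun x z => \sum_(y : ob C) comp (alg_at g y z) (alg_at f x y)).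

Definition alg1 : Alg C := \sum_(x : ob C) e_ x.

Lemma comp0m x y z (f : hom x y) : comp (0 : hom y z) f = 0.
Proof.
have := compPl (-1) (0 : hom y z) 0 f.
by rewrite scaler0 addr0 scaleN1r addNr.
Qed.

Lemma compm0 x y z (g : hom y z) : comp g (0 : hom x y) = 0.
Proof.
have := compPr (-1) g (0 : hom x y) 0.
by rewrite scaler0 addr0 scaleN1r addNr.
Qed.

Lemma compDl x y z (g g' : hom y z) (f : hom x y) :
  comp (g + g') f = comp g f + comp g' f.
Proof. by rewrite -[g]scale1r compPl !scale1r. Qed.

Lemma compDr x y z (g : hom y z) (f f' : hom x y) :
  comp g (f + f') = comp g f + comp g f'.
Proof. by rewrite -[f]scale1r compPr !scale1r. Qed.

Lemma compZl x y z c (g : hom y z) (f : hom x y) :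
  comp (c *: g) f = c *: comp g f.
Proof. by rewrite -[c *: g]addr0 compPl comp0m addr0. Qed.

Lemma compZr x y z c (g : hom y z) (f : hom x y) :
  comp g (c *: f) = c *: comp g f.
Proof. by rewrite -[c *: f]addr0 compPr compm0 addr0. Qed.

Lemma comp_suml I (r : seq I) (P : pred I) x y z
    (G : I -> hom y z) (f : hom x y) :
  comp (\sum_(i <- r | P i) G i) f = \sum_(i <- r | P i) comp (G i) f.
Proof.
by apply: (big_morph (fun g : hom y z => comp g f)) => [g g'|]; rewrite ?compDl ?comp0m.
Qed.

Lemma comp_sumr I (r : seq I) (P : pred I) x y z
    (g : hom y z) (F : I -> hom x y) :
  comp g (\sum_(i <- r | P i) F i) = \sum_(i <- r | P i) comp g (F i).
Proof.
by apply: (big_morph (fun f : hom x y => comp g f)) => [f f'|]; rewrite ?compDr ?compm0.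
Qed.

Lemma alg1_diag x : alg_at alg1 x x = idm x.
Proof.
rewrite alg_at_sum (bigD1 x) //= alg_in_at big1 ?addr0 // => y neq_yx.
by rewrite alg_in_out // xpair_eqE (negPf neq_yx).
Qed.

Lemma alg1_out x y : x != y -> alg_at alg1 x y = 0.
Proof.
move=> neq_xy; rewrite alg_at_sum big1 // => z _; rewrite alg_in_out //.
by apply: contraNneq neq_xy => -[-> ->].
Qed.

Fact alg_mulA : associative alg_mul.
Proof.
move=> h g f; apply/algP => x w; rewrite !alg_ofE.
under eq_bigr do rewrite alg_ofE comp_sumr.
under [RHS]eq_bigr do rewrite alg_ofE comp_suml.
rewrite exchange_big /=; apply: eq_bigr => y _; apply: eq_bigr => z _.
exact: compA.
Qed.

Fact alg_mul1l : left_id alg1 alg_mul.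
Proof.
move=> f; apply/algP => x z; rewrite alg_ofE (bigD1 z) //= alg1_diag comp1m.
by rewrite big1 ?addr0 // => y neq; rewrite alg1_out // comp0m.
Qed.

Fact alg_mul1r : right_id alg1 alg_mul.
Proof.
move=> f; apply/algP => x z; rewrite alg_ofE (bigD1 x) //= alg1_diag compm1.
by rewrite big1 ?addr0 // => y neq; rewrite alg1_out 1?eq_sym // compm0.
Qed.

Fact alg_mulDl : left_distributive alg_mul +%R.
Proof.
move=> g g' f; apply/algP => x z; rewrite alg_atD !alg_ofE -big_split /=.
by apply: eq_bigr => y _; rewrite alg_atD compDl.
Qed.

Fact alg_mulDr : right_distributive alg_mul +%R.
Proof.
move=> g f f'; apply/algP => x z; rewrite alg_atD !alg_ofE -big_split /=.
by apply: eq_bigr => y _; rewrite alg_atD compDr.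
Qed.

Fact alg_oner_neq0 : alg1 != 0.
Proof.
have [x x_neq0] := linCat_neq0 C; apply: contra_neq x_neq0 => alg1_0.
by rewrite -alg1_diag alg1_0 alg_at0.
Qed.

HB.instance Definition _ := GRing.Zmodule_isNzRing.Build (Alg C)
  alg_mulA alg_mul1l alg_mul1r alg_mulDl alg_mulDr alg_oner_neq0.

Fact alg_scaleAl c g f : c *: (g * f) = (c *: g) * f.
Proof.
apply/algP => x z; rewrite alg_atZ !alg_ofE scaler_sumr.
by apply: eq_bigr => y _; rewrite alg_atZ compZl.
Qed.

HB.instance Definition _ :=
  GRing.Lmodule_isLalgebra.Build k (Alg C) alg_scaleAl.

Fact alg_scaleAr c g f : c *: (g * f) = g * (c *: f).
Proof.
apply/algP => x z; rewrite alg_atZ !alg_ofE scaler_sumr.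
by apply: eq_bigr => y _; rewrite alg_atZ compZr.
Qed.

HB.instance Definition _ :=
  GRing.Lalgebra_isAlgebra.Build k (Alg C) alg_scaleAr.

Lemma alg_mulE g f x z :
  alg_at (g * f) x z = \sum_(y : ob C) comp (alg_at g y z) (alg_at f x y).
Proof. exact: alg_ofE. Qed.

Lemma mul_e_ x y : e_ x * e_ y = if x == y then e_ x else 0.
Proof.
apply/algP => u w; rewrite alg_mulE.
have [->|neq_xy] := eqVneq x y; last first.
  rewrite alg_at0 big1 // => v _; have [eq_xv|neq_xv] := eqVneq x v.
    rewrite [X in comp _ X]alg_in_out ?compm0 // xpair_eqE negb_and.
    by rewrite -eq_xv [y == x]eq_sym neq_xy orbT.
  by rewrite [X in comp X _]alg_in_out ?comp0m // xpair_eqE (negPf neq_xv).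
rewrite (bigD1 y) //= big1 ?addr0 => [|v neq_vy]; last first.
  rewrite [X in comp X _]alg_in_out ?comp0m // xpair_eqE.
  by rewrite [y == v]eq_sym (negPf neq_vy).
have [<-|neq_yw] := eqVneq y w; last first.
  rewrite [X in comp X _]alg_in_out ?comp0m 1?alg_in_out //;
    by rewrite xpair_eqE (negPf neq_yw) ?andbF.
by rewrite alg_in_at comp1m.
Qed.

End CategoryAlgebra.
Arguments e_ {k C} x.

Record idem (k : fieldType) (A : algType k) := Idem {
  idem_val : A;
  idemP : idem_val * idem_val = idem_val;
  idem_neq0 : idem_val != 0
}.

Section SumIdem.
Variables (k : fieldType) (C : linCat k) (I : finType) (g : I -> ob C).
Hypothesis g_inj : injective g.

Lemma mul_sum_e_l i : (\sum_j e_ (g j)) * e_ (g i) = e_ (g i).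
Proof.
rewrite mulr_suml (bigD1 i) //= mul_e_ eqxx big1 ?addr0 // => j neq_ji.
by rewrite mul_e_ (inj_eq g_inj) (negPf neq_ji).
Qed.

Lemma sum_e_idem : (\sum_i e_ (g i)) * (\sum_i e_ (g i)) = \sum_i e_ (g i).
Proof. by rewrite mulr_sumr; apply: eq_bigr => i _; rewrite mul_sum_e_l. Qed.

Lemma sum_e_neq0 i : idm (g i) != 0 -> \sum_j e_ (g j) != 0.
Proof.
apply: contra_neq => e_0; rewrite -[LHS]alg_in_at -/(e_ _).
by rewrite -mul_sum_e_l e_0 mul0r alg_at0.
Qed.

End SumIdem.

Section Corner.
Variables (k : fieldType) (A : algType k) (E : idem A).
Local Notation e := (idem_val E).

Definition corner_pred : {pred A} := fun x => e * x * e == x.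

(* The algebra e A e, with unit e; see cornerP. *)
Record corner := Corner { corner_val : A; _ : corner_val \in corner_pred }.

HB.instance Definition _ := [isSub for corner_val].
HB.instance Definition _ := [Choice of corner by <:].

Lemma mul_corner_l x : x \in corner_pred -> e * x = x.
Proof. by move/eqP <-; rewrite !mulrA idemP. Qed.

Lemma mul_corner_r x : x \in corner_pred -> x * e = x.
Proof. by move/eqP <-; rewrite -!mulrA idemP. Qed.

Lemma corner_proj_subproof x : e * x * e \in corner_pred.
Proof. by apply/eqP; rewrite !mulrA idemP -!mulrA idemP. Qed.

Lemma cornerP x : reflect (exists y, x = e * y * e) (x \in corner_pred).
Proof.
apply: (iffP idP) => [/eqP <-|[y ->]]; first by exists x.
exact: corner_proj_subproof.
Qed.

Definition corner_proj x := Corner (corner_proj_subproof x).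

Fact corner_submod : submod_closed corner_pred.
Proof.
split=> [|c x y /eqP xP /eqP yP]; first by apply/eqP; rewrite mulr0 mul0r.
by apply/eqP; rewrite mulrDr mulrDl -scalerAr -scalerAl xP yP.
Qed.

HB.instance Definition _ :=
  GRing.isSubmodClosed.Build k A corner_pred corner_submod.
HB.instance Definition _ := [SubChoice_isSubZmodule of corner by <:].
HB.instance Definition _ := [SubZmodule_isSubLmodule of corner by <:].

Fact corner_mul_subproof (x y : corner) : val x * val y \in corner_pred.
Proof.
apply/eqP; rewrite mulrA -[_ * _ * e]mulrA.
by rewrite (mul_corner_l (valP x)) (mul_corner_r (valP y)).
Qed.

Fact corner_one_subproof : e \in corner_pred.
Proof. by apply/eqP; rewrite !idemP. Qed.

Definition corner_mul x y := Corner (corner_mul_subproof x y).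
Definition corner_one := Corner corner_one_subproof.

Fact corner_mulA : associative corner_mul.
Proof. by move=> x y z; apply: val_inj; rewrite /= mulrA. Qed.
Fact corner_mul1l : left_id corner_one corner_mul.
Proof. by move=> x; apply: val_inj; exact: mul_corner_l (valP x). Qed.
Fact corner_mul1r : right_id corner_one corner_mul.
Proof. by move=> x; apply: val_inj; exact: mul_corner_r (valP x). Qed.
Fact corner_mulDl : left_distributive corner_mul +%R.
Proof. by move=> x y z; apply: val_inj; rewrite /= mulrDl. Qed.
Fact corner_mulDr : right_distributive corner_mul +%R.
Proof. by move=> x y z; apply: val_inj; rewrite /= mulrDr. Qed.
Fact corner_one_neq0 : corner_one != 0.
Proof. exact: idem_neq0. Qed.

HB.instance Definition _ := GRing.Zmodule_isNzRing.Build corner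
  corner_mulA corner_mul1l corner_mul1r corner_mulDl corner_mulDr
  corner_one_neq0.

Fact corner_scaleAl c (x y : corner) : c *: (x * y) = (c *: x) * y.
Proof. by apply: val_inj; rewrite /= scalerAl. Qed.
HB.instance Definition _ :=
  GRing.Lmodule_isLalgebra.Build k corner corner_scaleAl.

Fact corner_scaleAr c (x y : corner) : c *: (x * y) = x * (c *: y).
Proof. by apply: val_inj; rewrite /= scalerAr. Qed.
HB.instance Definition _ :=
  GRing.Lalgebra_isAlgebra.Build k corner corner_scaleAr.

End Corner.

Section ProjectiveEnd.
Variables (k : fieldType) (A : algType k) (E : idem A).
Local Notation e := (idem_val E).

Definition rproj_pred : {pred A} := fun x => e * x == x.

(* The projective right A-module e A. *)
Record rproj := Rproj { rproj_val : A; _ : rproj_val \in rproj_pred }.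

HB.instance Definition _ := [isSub for rproj_val].
HB.instance Definition _ := [Choice of rproj by <:].

Fact rproj_submod : submod_closed rproj_pred.
Proof.
split=> [|c x y /eqP xP /eqP yP]; first by apply/eqP; rewrite mulr0.
by apply/eqP; rewrite mulrDr -scalerAr xP yP.
Qed.

HB.instance Definition _ :=
  GRing.isSubmodClosed.Build k A rproj_pred rproj_submod.
HB.instance Definition _ := [SubChoice_isSubZmodule of rproj by <:].
HB.instance Definition _ := [SubZmodule_isSubLmodule of rproj by <:].

Fact ract_subproof (x : rproj) a : val x * a \in rproj_pred.
Proof. by apply/eqP; rewrite mulrA (eqP (valP x)). Qed.

Definition ract x a := Rproj (ract_subproof x a).

Definition rproj_endo (f : rproj -> rproj) : Prop :=
  linear f /\ forall x a, f (ract x a) = ract (f x) a.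

(* The endomorphism algebra of the right A-module e A, under composition. *)
Record rprojEnd := RprojEnd {
  rprojEnd_val :> rproj -> rproj;
  rprojEndP : rproj_endo rprojEnd_val
}.

HB.instance Definition _ := gen_eqMixin rprojEnd.
HB.instance Definition _ := gen_choiceMixin rprojEnd.

Lemma rprojEnd_ext (f g : rprojEnd) : f =1 g -> f = g.
Proof.
case: f g => [f fP] [g gP] /= /funext eq_fg.
by move: fP gP; rewrite eq_fg => fP gP; rewrite (Prop_irrelevance fP gP).
Qed.

Lemma rprojEndL (f : rprojEnd) : linear f. Proof. by case: (rprojEndP f). Qed.
Lemma rprojEndR (f : rprojEnd) x a : f (ract x a) = ract (f x) a.
Proof. by case: (rprojEndP f). Qed.

Lemma rprojEndD (f : rprojEnd) : {morph f : x y / x + y}.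
Proof. by move=> x y; rewrite -[x]scale1r rprojEndL !scale1r. Qed.

Lemma rprojEnd0 (f : rprojEnd) : f 0 = 0.
Proof. by apply: (addrI (f 0)); rewrite -rprojEndD !addr0. Qed.

Lemma rprojEndZ (f : rprojEnd) c x : f (c *: x) = c *: f x.
Proof. by rewrite -[c *: x]addr0 rprojEndL rprojEnd0 addr0. Qed.

Fact rend_zero_subproof : rproj_endo (fun=> 0).
Proof.
split=> [c x y|x a]; first by rewrite scaler0 addr0.
by apply: val_inj; rewrite /= mul0r.
Qed.
Definition rend_zero := RprojEnd rend_zero_subproof.

Fact rend_opp_subproof (f : rprojEnd) : rproj_endo (fun x => - f x).
Proof.
split=> [c x y|x a]; first by rewrite rprojEndL opprD scalerN.
by rewrite rprojEndR; apply: val_inj; rewrite /= mulNr.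
Qed.
Definition rend_opp f := RprojEnd (rend_opp_subproof f).

Fact rend_add_subproof (f g : rprojEnd) : rproj_endo (fun x => f x + g x).
Proof.
split=> [c x y|x a]; first by rewrite !rprojEndL scalerDr addrACA.
by rewrite !rprojEndR; apply: val_inj; rewrite /= mulrDl.
Qed.
Definition rend_add f g := RprojEnd (rend_add_subproof f g).

Fact rend_scale_subproof c (f : rprojEnd) : rproj_endo (fun x => c *: f x).
Proof.
split=> [d x y|x a]; first by rewrite rprojEndL scalerDr !scalerA mulrC.
by rewrite rprojEndR; apply: val_inj; rewrite /= scalerAl.
Qed.
Definition rend_scale c f := RprojEnd (rend_scale_subproof c f).

Fact rend_one_subproof : rproj_endo id.
Proof. by []. Qed.
Definition rend_one := RprojEnd rend_one_subproof.

Fact rend_mul_subproof (f g : rprojEnd) : rproj_endo (f \o g).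
Proof. by split=> [c x y|x a] /=; rewrite ?rprojEndL ?rprojEndR. Qed.
Definition rend_mul f g := RprojEnd (rend_mul_subproof f g).

Fact rend_addA : associative rend_add.
Proof. by move=> f g h; apply: rprojEnd_ext => x /=; rewrite addrA. Qed.
Fact rend_addC : commutative rend_add.
Proof. by move=> f g; apply: rprojEnd_ext => x /=; rewrite addrC. Qed.
Fact rend_add0 : left_id rend_zero rend_add.
Proof. by move=> f; apply: rprojEnd_ext => x /=; rewrite add0r. Qed.
Fact rend_addN : left_inverse rend_zero rend_opp rend_add.
Proof. by move=> f; apply: rprojEnd_ext => x /=; rewrite addNr. Qed.

HB.instance Definition _ :=
  GRing.isZmodule.Build rprojEnd rend_addA rend_addC rend_add0 rend_addN.

Fact rend_scaleA c d f : rend_scale c (rend_scale d f) = rend_scale (c * d) f.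
Proof. by apply: rprojEnd_ext => x /=; rewrite scalerA. Qed.
Fact rend_scale1 : left_id 1 rend_scale.
Proof. by move=> f; apply: rprojEnd_ext => x /=; rewrite scale1r. Qed.
Fact rend_scaleDr : right_distributive rend_scale +%R.
Proof. by move=> c f g; apply: rprojEnd_ext => x /=; rewrite scalerDr. Qed.
Fact rend_scaleDl f : {morph rend_scale^~ f : c d / c + d}.
Proof. by move=> c d; apply: rprojEnd_ext => x /=; rewrite scalerDl. Qed.

HB.instance Definition _ := GRing.Zmodule_isLmodule.Build k rprojEnd
  rend_scaleA rend_scale1 rend_scaleDr rend_scaleDl.

Fact rend_mulA : associative rend_mul.
Proof. by move=> f g h; apply: rprojEnd_ext. Qed.
Fact rend_mul1l : left_id rend_one rend_mul.
Proof. by move=> f; apply: rprojEnd_ext. Qed.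
Fact rend_mul1r : right_id rend_one rend_mul.
Proof. by move=> f; apply: rprojEnd_ext. Qed.
Fact rend_mulDl : left_distributive rend_mul +%R.
Proof. by move=> f g h; apply: rprojEnd_ext. Qed.
Fact rend_mulDr : right_distributive rend_mul +%R.
Proof. by move=> f g h; apply: rprojEnd_ext => x /=; rewrite rprojEndD. Qed.

Fact rproj_gen_subproof : e \in rproj_pred.
Proof. by apply/eqP; rewrite idemP. Qed.

Fact rend_one_neq0 : rend_one != 0.
Proof.
apply/eqP => /(congr1 (fun f : rprojEnd => val (f (Rproj rproj_gen_subproof)))).
by move=> /= e_0; have := idem_neq0 E; rewrite e_0 eqxx.
Qed.

HB.instance Definition _ := GRing.Zmodule_isNzRing.Build rprojEnd
  rend_mulA rend_mul1l rend_mul1r rend_mulDl rend_mulDr rend_one_neq0.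

Fact rend_scaleAl c (f g : rprojEnd) : c *: (f * g) = (c *: f) * g.
Proof. by apply: rprojEnd_ext. Qed.
HB.instance Definition _ :=
  GRing.Lmodule_isLalgebra.Build k rprojEnd rend_scaleAl.

Fact rend_scaleAr c (f g : rprojEnd) : c *: (f * g) = f * (c *: g).
Proof. by apply: rprojEnd_ext => x /=; rewrite -rprojEndZ. Qed.
HB.instance Definition _ :=
  GRing.Lalgebra_isAlgebra.Build k rprojEnd rend_scaleAr.

End ProjectiveEnd.

(* The category with Hom(x, y) = k f_yx if r x y and 0 otherwise, and with    *)
(* f_zy f_yx = f_zx if r x z and 0 otherwise. The hom space is realised as    *)
(* 'rV[k]_1 or 'rV[k]_0, f_yx being the constant vector 1.                    *)
Section ThinCat.
Variables (k : fieldType) (X : finType) (r : rel X).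
Hypothesis r_refl : reflexive r.
Hypothesis r_conv : forall x y z w,
  r x y -> r y z -> r z w -> r x w -> r x z && r y w.
Variable x0 : X.

Definition thin_hom (x y : X) : vectType k := 'rV[k]_(r x y).

Definition thin_gen (x y : X) : thin_hom x y := const_mx 1.

Definition thin_coef x y (f : thin_hom x y) : k := \sum_i f 0 i.

Definition thin_comp x y z (g : thin_hom y z) (f : thin_hom x y) :
  thin_hom x z := thin_coef g * thin_coef f *: thin_gen x z.

Lemma thin_coefE x y (f : thin_hom x y) : f = thin_coef f *: thin_gen x y.
Proof.
rewrite /thin_coef /thin_gen; move: f; rewrite /thin_hom.
case: (r x y) => f; apply/rowP => i; last by case: i.
by rewrite big_ord1 !mxE mulr1 [i]ord1.
Qed.

Lemma thin_coef_gen x y : thin_coef (thin_gen x y) = (r x y)%:R.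
Proof.
rewrite /thin_coef (eq_bigr (fun=> 1)) => [|i _]; last by rewrite mxE.
by rewrite sumr_const card_ord.
Qed.

Lemma thin_coef_out x y (f : thin_hom x y) : ~~ r x y -> thin_coef f = 0.
Proof.
rewrite /thin_coef; move: f; rewrite /thin_hom.
by case: (r x y) => // f _; rewrite big_ord0.
Qed.

Lemma thin_coefP x y c (f g : thin_hom x y) :
  thin_coef (c *: f + g) = c * thin_coef f + thin_coef g.
Proof.
rewrite /thin_coef mulr_sumr -big_split /=.
by apply: eq_bigr => i _; rewrite !mxE.
Qed.

Lemma thin_coefZ x y c (f : thin_hom x y) :
  thin_coef (c *: f) = c * thin_coef f.
Proof. by rewrite /thin_coef mulr_sumr; apply: eq_bigr => i _; rewrite !mxE. Qed.

Lemma thin_inj x y (f g : thin_hom x y) :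
  thin_coef f = thin_coef g -> f = g.
Proof. by move=> eq_fg; rewrite [f]thin_coefE eq_fg -thin_coefE. Qed.

Lemma thin_coef_comp x y z (g : thin_hom y z) (f : thin_hom x y) :
  thin_coef (thin_comp g f) = thin_coef g * thin_coef f * (r x z)%:R.
Proof. by rewrite thin_coefZ thin_coef_gen. Qed.

Fact thin_compA x y z w (h : thin_hom z w) (g : thin_hom y z)
    (f : thin_hom x y) :
  thin_comp h (thin_comp g f) = thin_comp (thin_comp h g) f.
Proof.
apply: thin_inj; rewrite !thin_coef_comp.
have [rxw|] := boolP (r x w); last by rewrite !mulr0.
have [rxy|/thin_coef_out->] := boolP (r x y); last by rewrite !(mulr0, mul0r).
have [ryz|/thin_coef_out->] := boolP (r y z); last by rewrite !(mulr0, mul0r).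
have [rzw|/thin_coef_out->] := boolP (r z w); last by rewrite !(mulr0, mul0r).
by have /andP[-> ->] := r_conv rxy ryz rzw rxw; rewrite !mulr1 mulrA.
Qed.

Fact thin_comp1m x y (f : thin_hom x y) : thin_comp (thin_gen y y) f = f.
Proof. by rewrite /thin_comp thin_coef_gen r_refl mul1r -thin_coefE. Qed.

Fact thin_compm1 x y (f : thin_hom x y) : thin_comp f (thin_gen x x) = f.
Proof. by rewrite /thin_comp thin_coef_gen r_refl mulr1 -thin_coefE. Qed.

Fact thin_compPl x y z c (g g' : thin_hom y z) (f : thin_hom x y) :
  thin_comp (c *: g + g') f = c *: thin_comp g f + thin_comp g' f.
Proof. by rewrite /thin_comp thin_coefP mulrDl scalerDl scalerA mulrA. Qed.

Fact thin_compPr x y z c (g : thin_hom y z) (f f' : thin_hom x y) :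
  thin_comp g (c *: f + f') = c *: thin_comp g f + thin_comp g f'.
Proof. by rewrite /thin_comp thin_coefP mulrDr scalerDl scalerA mulrCA. Qed.

Lemma thin_gen_neq0 x : thin_gen x x != 0.
Proof.
apply/eqP => /(congr1 (@thin_coef x x)); rewrite thin_coef_gen r_refl.
by rewrite /thin_coef big1 => [|i _]; [move/eqP; rewrite oner_eq0 | rewrite mxE].
Qed.

Fact thin_neq0 : exists x, thin_gen x x != 0.
Proof. by exists x0; exact: thin_gen_neq0. Qed.

Definition thinCat : linCat k := LinCat
  thin_compA thin_comp1m thin_compm1 thin_compPl thin_compPr thin_neq0.

End ThinCat.

Local Open Scope nat_scope.

(* Strictly increasing m-tuples with entries in {1, ..., N}; coordinates are  *)
(* indexed from 0, so that x_i is [x (i-1)].                                  *)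
Definition os_pred m N (x : {ffun 'I_m -> 'I_N.+1}) : bool :=
  [forall i, 0 < x i] && [forall i : 'I_m, forall j : 'I_m, (i < j) ==> (x i < x j)].

Record os m N := Os { os_val : {ffun 'I_m -> 'I_N.+1}; _ : os_pred os_val }.

HB.instance Definition _ m N := [isSub for @os_val m N].
#[hnf] HB.instance Definition _ m N := [Finite of os m N by <:].

Definition coord m N (x : os m N) (i : 'I_m) : nat := os_val x i.
Coercion coord : os >-> Funclass.

Lemma os_gt0 m N (x : os m N) i : 0 < x i.
Proof. by have /andP[/forallP/(_ i)] := valP x. Qed.

Lemma os_le m N (x : os m N) i : x i <= N.
Proof. by rewrite -ltnS ltn_ord. Qed.

Lemma os_mono m N (x : os m N) (i j : 'I_m) : i < j -> x i < x j.
Proof.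
by have /andP[_ /forallP/(_ i)/forallP/(_ j)/implyP] := valP x; exact.
Qed.

Lemma os_lt m N (x : os m N) (i j : 'I_m) : (x i < x j) = (i < j).
Proof.
apply/idP/idP=> [|/os_mono//]; apply: contraTT; rewrite -!leqNgt leq_eqVlt.
by case/predU1P=> [/val_inj->|/(os_mono x)/ltnW].
Qed.

Lemma os_gt_idx m N (x : os m N) (i : 'I_m) : i < x i.
Proof.
case: i => i; elim: i => [|i IHi] lt_im; first exact: os_gt0.
have := IHi (ltnW lt_im) => /leq_ltn_trans; apply; exact: os_mono.
Qed.

Lemma osP m N (x y : os m N) : (forall i, x i = y i) -> x = y.
Proof. by move=> eq_xy; apply/val_inj/ffunP => i; exact/val_inj/eq_xy. Qed.

Lemma mk_os_subproof m N (F : 'I_m -> nat) : (forall i, 0 < F i <= N) ->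
  (forall i j : 'I_m, i < j -> F i < F j) ->
  os_pred [ffun i => inord (F i) : 'I_N.+1].
Proof.
move=> F_bnd F_mono; have val_F i : (inord (F i) : 'I_N.+1) = F i :> nat.
  by rewrite inordK // ltnS; case/andP: (F_bnd i).
apply/andP; split; apply/forallP => i.
  by rewrite ffunE val_F; case/andP: (F_bnd i).
by apply/forallP => j; apply/implyP => /F_mono; rewrite !ffunE !val_F.
Qed.

Definition mk_os m N F F_bnd F_mono := Os (@mk_os_subproof m N F F_bnd F_mono).

Lemma mk_osE m N F (F_bnd : forall i, 0 < F i <= N)
    (F_mono : forall i j : 'I_m, i < j -> F i < F j) i :
  mk_os F_bnd F_mono i = F i.
Proof. by rewrite /coord ffunE inordK // ltnS; case/andP: (F_bnd i). Qed.

(* The relation x_1 <= y_1 < x_2 <= y_2 < ... < x_m <= y_m. *)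
Definition preceq m N (x y : os m N) : bool :=
  [forall i, x i <= y i] &&
  [forall i : 'I_m, forall j : 'I_m, (j == i.+1 :> nat) ==> (y i < x j)].

Lemma preceqP m N (x y : os m N) :
  reflect ((forall i, x i <= y i) /\
           forall i j : 'I_m, j = i.+1 :> nat -> y i < x j) (preceq x y).
Proof.
apply: (iffP andP) => [[/forallP le_xy /forallP lt_yx]|[le_xy lt_yx]].
  split=> // i j eq_ji.
  by have /forallP/(_ j)/implyP := lt_yx i; apply; apply/eqP.
split; apply/forallP => // i; apply/forallP => j; apply/implyP => /eqP.
exact: lt_yx.
Qed.

Fact preceq_refl m N : reflexive (@preceq m N).
Proof. by move=> x; apply/preceqP; split=> // i j eq_ji; rewrite os_mono ?eq_ji. Qed.

Fact preceq_conv m N (x y z w : os m N) :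
  preceq x y -> preceq y z -> preceq z w -> preceq x w ->
  preceq x z && preceq y w.
Proof.
move=> /preceqP[xy _] /preceqP[yz _] /preceqP[zw _] /preceqP[_ wx].
apply/andP; split; apply/preceqP; split=> [i|i j eq_ji].
- exact: leq_trans (xy i) (yz i).
- exact: leq_ltn_trans (zw i) (wx i j eq_ji).
- exact: leq_trans (yz i) (zw i).
- exact: leq_trans (wx i j eq_ji) (xy j).
Qed.

Section OsMin.
Variables n m : nat.

Fact os_min_bnd (i : 'I_m) : 0 < i.+1 <= n + m.
Proof. by rewrite /= (leq_trans (ltn_ord i)) // leq_addl. Qed.
Fact os_min_mono (i j : 'I_m) : i < j -> i.+1 < j.+1.
Proof. by []. Qed.

Definition os_min : os m (n + m) := mk_os os_min_bnd os_min_mono.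

End OsMin.

(* The algebra A_n^m is the category algebra of [higherA k n m]. For n >= 1,  *)
(* the size n + m - 1 of the ground set is n.-1 + m.                          *)
Definition higherA (k : fieldType) (n m : nat) : linCat k :=
  thinCat k (@preceq_refl m (n.-1 + m)) (@preceq_conv m (n.-1 + m))
    (os_min n.-1 m).

Lemma card_ord_lt n t : t <= n -> #|[pred i : 'I_n | i < t]| = t.
Proof.
move=> le_tn; rewrite -sum1_card; under eq_bigl do rewrite inE.
by rewrite (big_ord_narrow le_tn) sum1_card card_ord.
Qed.

Section RationalDyck.
Variables a b : nat.

(* For x the positions of the horizontal steps of a path, [hsteps x t] is the *)
(* abscissa reached after t steps, and t - hsteps x t is the ordinate.        *)
Definition hsteps (x : os a (b + a)) (t : nat) : nat := #|[pred i | x i <= t]|.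

Definition below_diag (x : os a (b + a)) : bool :=
  [forall t : 'I_(b + a).+1, a * (t - hsteps x t) <= b * hsteps x t].

Definition Dyck := {x : os a (b + a) | below_diag x}.

(* s is the ceiling of a / b. *)
Definition dyck_s : nat := (a + b.-1) %/ b.
Definition dyck_m : nat := a - dyck_s.

(* The bounds imply z_m <= b + m, so nothing is lost by working in            *)
(* os_m(b + m). With j counted from 0, the bound is j+1 + floor(b(s+j)/a).    *)
Definition Omega_pred (z : os dyck_m (b + dyck_m)) : bool :=
  [forall j : 'I_dyck_m, z j <= j.+1 + (b * (dyck_s + j)) %/ a].

Definition Omega := {z : os dyck_m (b + dyck_m) | Omega_pred z}.

Lemma hsteps_before (x : os a (b + a)) (i : 'I_a) : hsteps x (x i).-1 = i.
Proof.
rewrite -[RHS](card_ord_lt (ltnW (ltn_ord i))); apply: eq_card => j.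
by rewrite !inE -ltnS prednK ?os_gt0 // os_lt.
Qed.

Lemma Dyck_coord (l : Dyck) (i : 'I_a) : a * (val l i - i.+1) <= b * i.
Proof.
have lt_t : (val l i).-1 < (b + a).+1.
  by rewrite ltnS (leq_trans (leq_pred _)) ?os_le.
have /forallP/(_ (Ordinal lt_t)) /= := valP l.
rewrite hsteps_before; congr (_ * _ <= _).
by rewrite subnS; lia.
Qed.

Lemma Dyck_prefix (l : Dyck) (i : 'I_a) : i < dyck_s -> val l i = i.+1.
Proof.
move=> lt_is; have b_gt0 : 0 < b.
  by rewrite lt0n; apply: contraTneq lt_is => b0; rewrite /dyck_s b0 divn0.
have lt_bi : b * i < a.
  move: lt_is; rewrite /dyck_s leq_divRL // mulSn mulnC => le_bi.
  by move: b_gt0 le_bi; lia.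
have := leq_ltn_trans (Dyck_coord l i) lt_bi; have := os_gt_idx (val l) i.
case: (val l i - i.+1) (subnKC (os_gt_idx (val l) i)) => [|d] <- _; first lia.
by rewrite mulnS ltnNge leq_addr.
Qed.

Fact beta_idx_subproof (j : 'I_dyck_m) : dyck_s + j < a.
Proof. by rewrite -ltn_subRL. Qed.

Definition beta_idx j : 'I_a := Ordinal (beta_idx_subproof j).

Definition beta_coord (x : os a (b + a)) (j : 'I_dyck_m) : nat :=
  x (beta_idx j) - dyck_s.

Fact beta_bnd x j : 0 < beta_coord x j <= b + dyck_m.
Proof.
have := os_gt_idx x (beta_idx j); have := os_le x (beta_idx j).
by have := beta_idx_subproof j; rewrite /beta_coord /dyck_m /=; lia.
Qed.

Fact beta_mono x (i j : 'I_dyck_m) : i < j -> beta_coord x i < beta_coord x j.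
Proof.
move=> lt_ij; have lt_x : x (beta_idx i) < x (beta_idx j).
  by rewrite os_lt ltn_add2l.
by have := beta_bnd x i; rewrite /beta_coord; lia.
Qed.

Definition beta_os x : os dyck_m (b + dyck_m) :=
  mk_os (beta_bnd x) (@beta_mono x).

Fact beta_subproof (l : Dyck) : Omega_pred (beta_os (val l)).
Proof.
apply/forallP => j; rewrite mk_osE /beta_coord.
have a_gt0 : 0 < a := leq_ltn_trans (leq0n _) (beta_idx_subproof j).
have := Dyck_coord l (beta_idx j); rewrite mulnC -leq_divRL //=; lia.
Qed.

(* (x_1, ..., x_a) |-> (x_{s+1} - s, ..., x_a - s) *)
Definition beta (l : Dyck) : Omega := exist _ (beta_os (val l)) (beta_subproof l).

Lemma beta_inj : injective (fun l : Dyck => val (beta l)).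
Proof.
move=> l l' eq_b; apply/val_inj/osP => i.
have [lt_is|le_si] := ltnP i dyck_s; first by rewrite !Dyck_prefix.
have lt_j : i - dyck_s < dyck_m by rewrite ltn_sub2r // (leq_ltn_trans le_si).
move: (congr1 (fun z : os _ _ => z (Ordinal lt_j)) eq_b).
rewrite !mk_osE /beta_coord.
have -> : beta_idx (Ordinal lt_j) = i by apply: val_inj; rewrite /= subnKC.
have gt_s y : dyck_s <= (y : os a (b + a)) i.
  exact: leq_trans le_si (ltnW (os_gt_idx y i)).
by move/(congr1 (addn dyck_s)); rewrite !subnKC.
Qed.

Fact Dyck_min_subproof : below_diag (os_min b a).
Proof.
apply/forallP => t.
have [le_ta|lt_at] := leqP t a.
  suff -> : hsteps (os_min b a) t = t by rewrite subnn muln0.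
  rewrite -[RHS](card_ord_lt le_ta); apply: eq_card => i.
  by rewrite !inE mk_osE.
suff -> : hsteps (os_min b a) t = a.
  rewrite mulnC leq_mul2r leq_subLR; apply/orP; right.
  by have := ltn_ord t; rewrite ltnS [X in _ <= X -> _]addnC.
rewrite /hsteps -[RHS]card_ord; apply: eq_card => i; rewrite !inE mk_osE.
exact: ltn_trans (ltn_ord i) lt_at.
Qed.

Definition Dyck_min : Dyck := exist _ (os_min b a) Dyck_min_subproof.

Variable k : fieldType.

(* The category C_{m-1}(Omega_{a,b}). *)
Definition OmegaCat : linCat k :=
  @thinCat k Omega (fun x y => preceq (val x) (val y))
    (fun x => preceq_refl (val x))
    (fun x y z w => @preceq_conv _ _ (val x) (val y) (val z) (val w))
    (beta Dyck_min).

Local Open Scope ring_scope.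

Definition beta_sum : Alg (higherA k b.+1 dyck_m) :=
  \sum_(l : Dyck) e_ (val (beta l) : ob (higherA k b.+1 dyck_m)).

Fact beta_sum_idem : beta_sum * beta_sum = beta_sum.
Proof. exact: (@sum_e_idem _ (higherA k b.+1 dyck_m) _ _ beta_inj). Qed.

Fact beta_sum_neq0 : beta_sum != 0.
Proof.
apply: (@sum_e_neq0 _ (higherA k b.+1 dyck_m) _ _ beta_inj Dyck_min).
exact/thin_gen_neq0/preceq_refl.
Qed.

Definition beta_idem := Idem beta_sum_idem beta_sum_neq0.

Definition Bst := corner beta_idem.

Definition dyck_sum : Alg (higherA k b.+1 a) :=
  \sum_(l : Dyck) e_ (val l : ob (higherA k b.+1 a)).

Fact dyck_sum_idem : dyck_sum * dyck_sum = dyck_sum.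
Proof. exact: (@sum_e_idem _ (higherA k b.+1 a) _ _ val_inj). Qed.

Fact dyck_sum_neq0 : dyck_sum != 0.
Proof.
apply: (@sum_e_neq0 _ (higherA k b.+1 a) _ _ val_inj Dyck_min).
exact/thin_gen_neq0/preceq_refl.
Qed.

Definition dyck_idem := Idem dyck_sum_idem dyck_sum_neq0.

(* The endomorphism algebra of the sum of the projective modules e_l A over   *)
(* the Dyck paths l, where A = A_{b+1}^a. Right modules are used, so that it  *)
(* is e A e and not its opposite.                                             *)
Definition XingB0 := rprojEnd dyck_idem.

HB.instance Definition _ := GRing.Algebra.on Bst.
HB.instance Definition _ := GRing.Algebra.on XingB0.

End RationalDyck.

(* Main.v *)
(* A Dyck path is determined by its shifted tail, so beta is bijective; since *)
(* the forced prefix (1, ..., s) interlaces with itself, beta also preserves  *)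
(* and reflects the interlacing relation. A corner of a thin category algebra *)
(* at a sum of distinct vertex idempotents is the algebra of the full         *)
(* subcategory on these vertices. Apply this to the paths inside              *)
(* A_{b+1}^m (through beta) and inside A_{b+1}^a; for the latter,             *)
(* End(e A) = e A e by evaluation at e.                                 *)
Require Import Defs.
From HB Require Import structures.
From mathcomp Require Import all_boot all_order all_algebra.
From mathcomp Require Import zify.
Import GRing.Theory.
Local Open Scope ring_scope.

Set Implicit Arguments.
Unset Strict Implicit.
Unset Printing Implicit Defensive.

(** Elements of a thin category algebra are matrices supported on the relation. Cutting by a sum of
    vertex idempotents keeps the entries between the chosen objects and, in products, only the
    intermediate objects among them. The corner thus depends only on the relation restricted to
    these objects ([corner_thinCat]). For [Bst] they are the tuples [beta l], which [beta_bij]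
    identifies with [Omega]. For [XingB0], evaluation at the generator turns endomorphisms into
    corner elements ([rprojEnd_corner]), and [preceq_beta] matches the relation on whole paths with
    that on shifted tails. *)

Lemma lrmorphism_of (k : fieldType) (A B : algType k) (f : A -> B) :
  linear f -> monoid_morphism f ->
  exists phi : {lrmorphism A -> B}, phi =1 f.
Proof.
move=> f_lin f_mon.
pose lM := GRing.isLinear.Build k A B _ f f_lin.
pose mM := GRing.isMonoidMorphism.Build A B f f_mon.
pose phi : {lrmorphism A -> B} := HB.pack f lM mM.
by exists phi.
Qed.

(** * Multiplication by sums of vertex idempotents *)

Section MulE.
Variables (k : fieldType) (C : linCat k).
Implicit Types (f : Alg C) (x y u : ob C).

Lemma alg_at_e_ u : alg_at (e_ u) u u = idm u.
Proof. exact: alg_in_at. Qed.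

(** Products are compositions, so a left factor [e_ u] selects targets and a right factor selects
    sources. *)
Lemma alg_at_e_mul u f x y :
  alg_at (e_ u * f) x y = if y == u then alg_at f x y else 0.
Proof.
rewrite alg_mulE; have [->|neq_yu] := eqVneq y u.
  rewrite (bigD1 u) //= alg_at_e_ comp1m big1 ?addr0 // => v neq_vu.
  by rewrite alg_in_out ?comp0m // xpair_eqE eq_sym (negPf neq_vu).
rewrite big1 // => v _.
by rewrite alg_in_out ?comp0m // xpair_eqE andbC eq_sym (negPf neq_yu).
Qed.

Lemma alg_at_mul_e u f x y :
  alg_at (f * e_ u) x y = if x == u then alg_at f x y else 0.
Proof.
rewrite alg_mulE; have [->|neq_xu] := eqVneq x u.
  rewrite (bigD1 u) //= alg_at_e_ compm1 big1 ?addr0 // => v neq_vu.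
  by rewrite alg_in_out ?compm0 // xpair_eqE andbC eq_sym (negPf neq_vu).
rewrite big1 // => v _.
by rewrite alg_in_out ?compm0 // xpair_eqE eq_sym (negPf neq_xu).
Qed.

Variables (I : finType) (g : I -> ob C).
Hypothesis g_inj : injective g.

Lemma alg_at_sum_e_mul f x y :
  alg_at ((\sum_i e_ (g i)) * f) x y =
  if y \in codom g then alg_at f x y else 0.
Proof.
rewrite mulr_suml alg_at_sum; under eq_bigr do rewrite alg_at_e_mul.
case: codomP => [[i ->]|y_out]; last first.
  by rewrite big1 // => i _; case: eqP => // y_gi; case: y_out; exists i.
rewrite (bigD1 i) //= eqxx big1 ?addr0 // => j neq_ji.
by rewrite (inj_eq g_inj) eq_sym (negPf neq_ji).
Qed.

Lemma alg_at_mul_sum_e f x y :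
  alg_at (f * (\sum_i e_ (g i))) x y =
  if x \in codom g then alg_at f x y else 0.
Proof.
rewrite mulr_sumr alg_at_sum; under eq_bigr do rewrite alg_at_mul_e.
case: codomP => [[i ->]|x_out]; last first.
  by rewrite big1 // => i _; case: eqP => // x_gi; case: x_out; exists i.
rewrite (bigD1 i) //= eqxx big1 ?addr0 // => j neq_ji.
by rewrite (inj_eq g_inj) eq_sym (negPf neq_ji).
Qed.

End MulE.

Lemma sum_codom (V : nmodType) (I X : finType) (g : I -> X) (F : X -> V) :
  injective g -> (forall x, x \notin codom g -> F x = 0) ->
  \sum_x F x = \sum_i F (g i).
Proof.
move=> g_inj F_out; rewrite (bigID (mem (codom g))) /=.
rewrite [X in _ + X]big1 ?addr0 // -big_uniq ?big_image //.
by rewrite map_inj_uniq ?enum_uniq.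
Qed.

(** * Corners of thin category algebras *)

Section ThinCorner.
Variables (k : fieldType) (X Y : finType) (r : rel X) (q : rel Y).
Hypotheses (r_refl : reflexive r) (q_refl : reflexive q).
Hypothesis r_conv : forall x y z w,
  r x y -> r y z -> r z w -> r x w -> r x z && r y w.
Hypothesis q_conv : forall x y z w,
  q x y -> q y z -> q z w -> q x w -> q x z && q y w.
Variables (x0 : X) (y0 : Y).
Let CX := thinCat k r_refl r_conv x0.
Let CY := thinCat k q_refl q_conv y0.

Lemma thinCat_algP (f f' : Alg CY) :
  (forall u v : Y, thin_coef (alg_at f u v : thin_hom k q u v) =
                   thin_coef (alg_at f' u v : thin_hom k q u v)) -> f = f'.
Proof. by move=> eq_ff'; apply/algP => u v; exact: thin_inj. Qed.

Variables (I : finType) (g : I -> X) (h : I -> Y).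
Hypotheses (g_inj : injective g) (h_bij : bijective h).
Hypothesis rE : forall i j, q (h i) (h j) = r (g i) (g j).

Variable E : idem (Alg CX).
Hypothesis E_sum : idem_val E = \sum_i e_ (g i : ob CX).

Let cX (f : Alg CX) (x y : X) : k := thin_coef (alg_at f x y : thin_hom k r x y).
Let cY (f : Alg CY) (x y : Y) : k := thin_coef (alg_at f x y : thin_hom k q x y).

Let cX_P c f f' x y : cX (c *: f + f') x y = c * cX f x y + cX f' x y.
Proof. by rewrite /cX alg_atD alg_atZ thin_coefP. Qed.

Let cX_out f x y : ~~ r x y -> cX f x y = 0.
Proof. exact: thin_coef_out. Qed.

Let cY_out f x y : ~~ q x y -> cY f x y = 0.
Proof. exact: thin_coef_out. Qed.

Lemma thin_coef0 (Z : finType) (s : rel Z) x y :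
  thin_coef (0 : thin_hom k s x y) = 0.
Proof. by rewrite -[0](scale0r 0) thin_coefZ mul0r. Qed.

Lemma thin_coef_sum (Z : finType) (s : rel Z) x y (J : Type) (l : seq J)
    (P : pred J) (F : J -> thin_hom k s x y) :
  thin_coef (\sum_(i <- l | P i) F i) = \sum_(i <- l | P i) thin_coef (F i).
Proof.
apply: (big_morph (@thin_coef k Z s x y)) => [f f'|]; last exact: thin_coef0.
by rewrite -[f]scale1r thin_coefP mul1r scale1r.
Qed.

(** The factor [(r x z)%:R] encodes that a composite is 0 when the hom space from [x] to [z] is
    0. *)
Let cX_M f f' x z : cX (f * f') x z =
  (\sum_y cX f y z * cX f' x y) * (r x z)%:R.
Proof.
rewrite /cX alg_mulE thin_coef_sum mulr_suml.
by apply: eq_bigr => y _; rewrite [LHS]thin_coef_comp.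
Qed.

Let cY_M f f' x z : cY (f * f') x z =
  (\sum_y cY f y z * cY f' x y) * (q x z)%:R.
Proof.
rewrite /cY alg_mulE thin_coef_sum mulr_suml.
by apply: eq_bigr => y _; rewrite [LHS]thin_coef_comp.
Qed.

Let cX_corner f x y : f \in corner_pred E ->
  cX f x y = if (x \in codom g) && (y \in codom g) then cX f x y else 0.
Proof.
move/eqP=> fE; rewrite -[in LHS]fE E_sum /cX alg_at_mul_sum_e //.
rewrite alg_at_sum_e_mul //.
by case: (x \in codom g) => /=; case: (y \in codom g) => //; rewrite thin_coef0.
Qed.

Let to_thin (f : corner E) (h' : Y -> I) : Alg CY :=
  alg_of (C := CY) (fun u v : Y =>
    cX (val f) (g (h' u)) (g (h' v)) *: thin_gen k q u v).

(** The double sum stands for a partial inverse of [g]: by injectivity it has one term on the image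
    of [g], and it is empty elsewhere. *)
Let of_coef (f : Alg CY) : Alg CX :=
  alg_of (C := CX) (fun x y : X =>
    (\sum_(i | g i == x) \sum_(j | g j == y) cY f (h i) (h j)) *: thin_gen k r x y).

(** A corner element is determined by its entries at pairs [(g i, g j)]; by [rE] these are the
    entries at [(h i, h j)] of an arbitrary element of [Alg CY]. *)
Lemma corner_thinCat :
  exists phi : {lrmorphism corner E -> Alg CY}, bijective phi /\
    forall i, phi (corner_proj E (e_ (g i : ob CX))) = e_ (h i : ob CY).
Proof.
have [h' hK h'K] := h_bij.
pose F f := to_thin f h'.
have FE f i j : cY (F f) (h i) (h j) = cX (val f) (g i) (g j).
  rewrite /cY /F alg_ofE thin_coefZ thin_coef_gen !hK rE.
  by have [_|/cX_out->] := boolP (r _ _); rewrite ?mulr1 ?mul0r.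
have extY (f f' : Alg CY) :
    (forall i j, cY f (h i) (h j) = cY f' (h i) (h j)) -> f = f'.
  by move=> eq_c; apply: thinCat_algP => u v; rewrite -[u]h'K -[v]h'K; exact: eq_c.
have Flin : linear F.
  move=> c f f'; apply: extY => i j.
  by rewrite FE /cY alg_atD alg_atZ thin_coefP -!/(cY _ _ _) !FE -cX_P.
have Fe i : F (corner_proj E (e_ (g i : ob CX))) = e_ (h i : ob CY).
  apply: extY => j l; rewrite FE /= E_sum /cX /cY.
  rewrite alg_at_mul_sum_e // alg_at_sum_e_mul // !codom_f.
  have [/eqP[-> ->]|neq] := boolP ((i, i) == (j, l)).
    by rewrite !alg_in_at !thin_coef_gen r_refl q_refl.
  rewrite !alg_in_out ?thin_coef0 //; move: neq; rewrite !xpair_eqE.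
    by rewrite !(can_eq hK).
  by rewrite !(inj_eq g_inj).
have F1 : F 1 = 1.
  (* The unit of the corner is the idempotent; written as itself times 1, its entries are those of 1
     on the image of [g]. *)
  apply: extY => i j; rewrite FE /= E_sum -[\sum_i _]mulr1 /cX /cY.
  rewrite alg_at_sum_e_mul // codom_f.
  have [->|neq_ij] := eqVneq i j.
    by rewrite !alg1_diag !thin_coef_gen r_refl q_refl.
  by rewrite !alg1_out ?thin_coef0 ?(can_eq hK) ?(inj_eq g_inj).
have FM : {morph F : f f' / f * f'}.
  move=> f f'; apply: extY => i j; rewrite FE cY_M rE cX_M; congr (_ * _).
  (* Intermediate objects outside the image of [g] contribute 0, so both products become sums over
     [I]. *)
  rewrite (sum_codom g_inj) => [|x x_out]; last first.
    by rewrite (cX_corner _ _ (valP f)) (negPf x_out) mul0r.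
  rewrite [RHS](reindex h) /=; last exact: onW_bij.
  by apply: eq_bigr => l _; rewrite !FE.
have [phi phiE] := lrmorphism_of Flin (F1, FM).
exists phi; split=> [|i]; last by rewrite phiE Fe.
apply: (eq_bij _ (fsym phiE)).
have extX (f f' : corner E) :
    (forall i j, cX (val f) (g i) (g j) = cX (val f') (g i) (g j)) -> f = f'.
  move=> eq_c; apply/val_inj/algP => x y; apply: thin_inj.
  rewrite -!/(cX _ x y) (cX_corner _ _ (valP f)) (cX_corner _ _ (valP f')).
  case: codomP => //= -[i ->]; case: codomP => //= -[j ->]; exact: eq_c.
have of_coefE f i j : cX (val (corner_proj E (of_coef f))) (g i) (g j)
    = cY f (h i) (h j).
  rewrite /= E_sum /cX alg_at_mul_sum_e // alg_at_sum_e_mul // !codom_f.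
  rewrite alg_ofE thin_coefZ thin_coef_gen -rE.
  rewrite (big_pred1 i) => [|l]; last by rewrite (inj_eq g_inj).
  rewrite (big_pred1 j) => [|l]; last by rewrite (inj_eq g_inj).
  by have [_|/cY_out->] := boolP (q _ _); rewrite ?mulr1 ?mul0r.
exists (fun f => corner_proj E (of_coef f)) => [f|f].
  by apply: extX => i j; rewrite of_coefE FE.
by apply: extY => i j; rewrite FE of_coefE.
Qed.

End ThinCorner.

(** * Endomorphisms of the right module generated by an idempotent *)

Section RprojEndCorner.
Variables (k : fieldType) (A : algType k) (E : idem A).
Local Notation e := (idem_val E).

Let gen : rproj E := Rproj (rproj_gen_subproof E).

Let rproj_actE (x : rproj E) : ract gen (val x) = x.
Proof. by apply: val_inj; rewrite /= (eqP (valP x)). Qed.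

(** Right linearity gives [f e = f (e e) = (f e) e], and [f e] already lies in [e A]. *)
Let eval_subproof (f : rprojEnd E) : val (f gen) \in corner_pred E.
Proof.
have gen_e : ract gen e = gen by apply: val_inj; rewrite /= idemP.
have /eqP e_f := valP (f gen).
by apply/eqP; rewrite e_f -[in RHS]gen_e rprojEndR.
Qed.

Let lmul_subproof (x : corner E) (y : rproj E) : val x * val y \in rproj_pred E.
Proof. by apply/eqP; rewrite mulrA (mul_corner_l (valP x)). Qed.

Let lmul_endo (x : corner E) : rproj_endo (fun y => Rproj (lmul_subproof x y)).
Proof.
split=> [c y z|y a]; apply: val_inj; rewrite /= ?mulrA //.
by rewrite mulrDr scalerAr.
Qed.

(** Since [e] generates [e A], evaluation at [e] is inverse to left multiplication;
    [f (f' e) = f (e (f' e)) = (f e) (f' e)] shows that the order of products is kept. *)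
Lemma rprojEnd_corner :
  exists theta : {lrmorphism rprojEnd E -> corner E}, bijective theta.
Proof.
pose F f := Corner (eval_subproof f).
have Flin : linear F by move=> c f f'; apply: val_inj.
have F1 : F 1 = 1 by apply: val_inj.
have FM : {morph F : f f' / f * f'}.
  move=> f f'; apply: val_inj => /=.
  by rewrite -[in LHS](rproj_actE (f' gen)) rprojEndR.
have [theta thetaE] := lrmorphism_of Flin (F1, FM).
exists theta; apply: (eq_bij _ (fsym thetaE)).
exists (fun x => RprojEnd (lmul_endo x)) => [f|x].
  apply: rprojEnd_ext => y; apply: val_inj => /=.
  by rewrite -[in RHS](rproj_actE y) rprojEndR.
by apply: val_inj; rewrite /= (mul_corner_r (valP x)).
Qed.

End RprojEndCorner.

Local Open Scope nat_scope.

(** * Bijectivity of [beta] and comparison of the relations *)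

Section Beta.
Variables a b : nat.
Local Notation s := (dyck_s a b).
Local Notation m := (dyck_m a b).

(** The height at time [t] is at most the height at which the next horizontal step starts, while the
    abscissa is the same; so testing the starts of horizontal steps suffices. After the last one,
    the height is at most [b]. *)
Lemma below_diag_coord (x : os a (b + a)) :
  (forall i : 'I_a, a * (x i - i.+1) <= b * i) -> below_diag x.
Proof.
move=> x_le; apply/forallP => t; set h := hsteps x t.
have le_ha : h <= a by rewrite -[X in _ <= X]card_ord max_card.
have [eq_ha|neq_ha] := eqVneq h a.
  by rewrite eq_ha mulnC leq_mul2r leq_subLR [a + b]addnC -ltnS ltn_ord orbT.
have lt_ha : h < a by rewrite ltn_neqAle neq_ha.
(* Otherwise the first [h + 1] horizontal steps would all occur by time [t], against the count
   [h]. *)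
have lt_tx : t < x (Ordinal lt_ha).
  rewrite ltnNge; apply: contraTN (leqnn h.+1) => le_xt; rewrite -ltnNge ltnS.
  rewrite -[X in X <= _](card_ord_lt lt_ha); apply/subset_leq_card/subsetP => i.
  rewrite !inE ltnS leq_eqVlt => /predU1P[eq_ih|lt_ih].
    by rewrite (_ : i = Ordinal lt_ha) //; exact: val_inj.
  exact: leq_trans (ltnW (os_mono x (j := Ordinal lt_ha) lt_ih)) le_xt.
apply: leq_trans (x_le (Ordinal lt_ha)); rewrite leq_mul2l /=; lia.
Qed.

Section BetaInv.
Variable z : Omega a b.

Let le_z (j : 'I_m) : val z j <= j.+1 + (b * (s + j)) %/ a.
Proof. by have /forallP := valP z. Qed.

(* The test [s <= i] is needed: for [i < s], [i - s] truncates to 0. *)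
Let F (i : 'I_a) : nat :=
  if insub (i - s) is Some j then
    if s <= i then val z j + s else i.+1
  else i.+1.

Variant beta_inv_spec (i : 'I_a) : nat -> Prop :=
  | BetaInvPrefix of i < s : beta_inv_spec i i.+1
  | BetaInvShift (j : 'I_m) of i = s + j :> nat : beta_inv_spec i (val z j + s).

Let FP i : beta_inv_spec i (F i).
Proof.
rewrite /F; have [lt_is|le_si] := ltnP i s.
  by case: insub => [j|]; constructor.
have lt_j : i - s < m by rewrite ltn_sub2r // (leq_ltn_trans le_si).
by rewrite insubT; constructor; rewrite /= subnKC.
Qed.

Fact beta_inv_bnd i : 0 < F i <= b + a.
Proof.
have := ltn_ord i; case: FP => [|j ->] lt_ia; first by lia.
by have := os_gt0 (val z) j; have := os_le (val z) j; rewrite /m; lia.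
Qed.

Fact beta_inv_mono (i i' : 'I_a) : i < i' -> F i < F i'.
Proof.
case: (FP i) => [lt_is|j ->]; case: (FP i') => [lt_is'|j' ->] //.
- by move=> _; have := os_gt_idx (val z) j'; lia.
- by lia.
by rewrite ltn_add2l ltn_add2r os_lt.
Qed.

Fact beta_inv_below : below_diag (mk_os beta_inv_bnd beta_inv_mono).
Proof.
apply: below_diag_coord => i; rewrite mk_osE.
have a_gt0 : 0 < a by apply: leq_ltn_trans (ltn_ord i).
case: FP => [|j ->]; first by rewrite subnn muln0.
(* At index [s + j] the diagonal condition is exactly the bound defining [Omega]; the floor is then
   made opaque for [lia]. *)
rewrite mulnC -leq_divRL //; move: (le_z j); set q := _ %/ a.
by clearbody q; lia.
Qed.

Definition beta_inv : Dyck a b :=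
  exist _ (mk_os beta_inv_bnd beta_inv_mono) beta_inv_below.

Lemma beta_invK : beta beta_inv = z.
Proof.
apply/val_inj/osP => j; rewrite mk_osE /beta_coord /= mk_osE.
case: FP => [|j']; rewrite /= ?ltnNge ?leq_addr // => /addnI/val_inj <-.
by rewrite addnK.
Qed.

End BetaInv.

Lemma beta_bij : bijective (@beta a b).
Proof.
exists beta_inv => [l|]; last exact: beta_invK.
by apply: beta_inj; rewrite beta_invK.
Qed.

(* The prefixes [1, ..., s] of two Dyck paths always interlace, and the last  *)
(* prefix step [s] precedes every later horizontal step.                      *)
Lemma preceq_beta (l l' : Dyck a b) :
  preceq (val (beta l)) (val (beta l')) = preceq (val l) (val l').
Proof.
have shift (x : os a (b + a)) j : x (beta_idx j) = beta_coord x j + s.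
  rewrite /beta_coord subnK //.
  by apply: leq_trans (ltnW (os_gt_idx x (beta_idx j))); rewrite leq_addr.
have idxP (i : 'I_a) : s <= i -> exists j : 'I_m, i = beta_idx j.
  move=> le_si; have lt_j : i - s < m by rewrite ltn_sub2r // (leq_ltn_trans le_si).
  by exists (Ordinal lt_j); apply: val_inj; rewrite /= subnKC.
apply/preceqP/preceqP => -[le_ll lt_ll]; split=> [i|i i' eq_i].
- have [lt_is|/idxP[j ->]] := ltnP i s; first by rewrite !Dyck_prefix.
  by have := le_ll j; rewrite !mk_osE !shift leq_add2r.
- have [lt_is|/idxP[j eq_ij]] := ltnP i s.
    (* With indices from 0, the prefix step sits at [i + 1 = i'], below the coordinate of index [i']
       of any tuple. *)
    by rewrite Dyck_prefix // -eq_i os_gt_idx.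
  have /idxP[j' eq_ij'] : s <= i' by rewrite eq_i eq_ij /= -addnS leq_addr.
  have := lt_ll j j'; rewrite eq_ij eq_ij' !mk_osE !shift ltn_add2r; apply.
  by move: eq_i; rewrite eq_ij eq_ij' /= -addnS => /addnI.
- by rewrite !mk_osE; have := le_ll (beta_idx i); rewrite !shift leq_add2r.
rewrite !mk_osE; have := lt_ll (beta_idx i) (beta_idx i').
by rewrite !shift ltn_add2r; apply; rewrite /= eq_i addnS.
Qed.

End Beta.

Local Open Scope ring_scope.

Theorem proposition5p5 (k : fieldType) (a b : nat)
    (ha : (2 <= a)%N) (hb : (2 <= b)%N) :
  [/\ bijective (@beta a b),
      exists phi : {lrmorphism Bst a b k -> Alg (OmegaCat a b k)},
        bijective phi /\
        forall l : Dyck a b,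
          phi (corner_proj (beta_idem a b k)
                 (e_ (val (beta l) : ob (higherA k b.+1 (dyck_m a b))))) =
          e_ (beta l : ob (OmegaCat a b k))
    & coprime a b ->
      exists psi : {lrmorphism XingB0 a b k -> Alg (OmegaCat a b k)},
        bijective psi].
Proof.
split=> [||_]; first exact: beta_bij.
  (* The relation of [OmegaCat] is by definition [preceq] on the underlying tuples, so the
     compatibility of the relations is trivial here. *)
  exact: (@corner_thinCat k _ _ _ _ _ _ _ _ _ _ _
    (fun l : Dyck a b => val (beta l)) (@beta a b) (@beta_inj a b)
    (beta_bij a b) _ (beta_idem a b k)).
have [theta theta_bij] := rprojEnd_corner (dyck_idem a b k).
(* Here the vertices are the full paths, and [preceq_beta] supplies the compatibility of the
   relations. *)
have [phi [phi_bij _]] := @corner_thinCat k _ _ _ _ (@preceq_refl a (b + a))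
  (fun z : Omega a b => preceq_refl (val z)) (@preceq_conv a (b + a))
  (fun x y z w : Omega a b => @preceq_conv _ _ (val x) (val y) (val z) (val w))
  (os_min b a) (beta (Dyck_min a b)) _
  (fun l : Dyck a b => val l) (@beta a b) val_inj
  (beta_bij a b) (@preceq_beta a b) (dyck_idem a b k) erefl.
by exists (phi \o theta); exact: bij_comp.
Qed.
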